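(* Let $b,c\in\mathbb{R}$ with $c\neq 0$, and let $(P_n)_{n\ge 0}$ be the generalized Padovan sequence defined by $P_0=0$, $P_1=1$, $P_2=0$ and $P_{n+3}=bP_{n+1}+cP_n$ for $n\ge 0$. Let $\{x_n,y_n\}_{n\ge -1}$ be a well defined solution of the system $$x_{n+1}=\frac{bx_{n-1}+c}{y_nx_{n-1}},\qquad y_{n+1}=\frac{by_{n-1}+c}{x_ny_{n-1}},\qquad n=0,1,\ldots.$$ Then, for $n=0,1,\ldots$, $$x_{2n+1}=\frac{cP_{2n+1}+P_{2n+3}x_{-1}+P_{2n+2}x_{-1}y_0}{cP_{2n}+P_{2n+2}x_{-1}+P_{2n+1}x_{-1}y_0},$$ $$x_{2n+2}=\frac{cP_{2n+2}+P_{2n+4}y_{-1}+P_{2n+3}x_0y_{-1}}{cP_{2n+1}+P_{2n+3}y_{-1}+P_{2n+2}x_0y_{-1}},$$ $$y_{2n+1}=\frac{cP_{2n+1}+P_{2n+3}y_{-1}+P_{2n+2}x_0y_{-1}}{cP_{2n}+P_{2n+2}y_{-1}+P_{2n+1}x_0y_{-1}},$$ $$y_{2n+2}=\frac{cP_{2n+2}+P_{2n+4}x_{-1}+P_{2n+3}x_{-1}y_0}{cP_{2n+1}+P_{2n+3}x_{-1}+P_{2n+2}x_{-1}y_0}.$$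
   Context: All quantities are real. A solution $\{x_n,y_n\}_{n\ge -1}$ of the system is called well defined if $x_ny_n\neq 0$ for all $n=-1,0,1,\ldots$ (so that every step of the recursion makes sense). *)

(* Defs.v *)
From HB Require Import structures.
From mathcomp Require Import all_boot all_order all_algebra.
From mathcomp Require Import reals.

Set Implicit Arguments.
Unset Strict Implicit.
Unset Printing Implicit Defensive.

Import Order.TTheory GRing.Theory Num.Theory.

Local Open Scope ring_scope.

Fixpoint padovan (R : realType) (b c : R) (n : nat) : R :=
  match n with
  | 0%N => 0
  | 1%N => 1
  | 2%N => 0
  | (m.+1 as m1).+2 => b * padovan b c m1 + c * padovan b c m
  end.

(* Sequences indexed by n >= -1 are functions on [int]; their values at
   indices below -1 are never constrained nor used. *)
Definition is_solution (R : realType) (b c : R) (x y : int -> R) : Prop :=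
  forall n : int, 0 <= n ->
    x (n + 1) = (b * x (n - 1) + c) / (y n * x (n - 1)) /\
    y (n + 1) = (b * y (n - 1) + c) / (x n * y (n - 1)).

(* Since [x n * y n != 0] for all n >= -1, no division in [is_solution] is by
   zero. *)
Definition well_defined (R : realType) (x y : int -> R) : Prop :=
  forall n : int, -1 <= n -> x n * y n != 0.

(* Main.v *)
(* The system decouples into the two interlaced sequences x_{-1}, y_0, x_1, ...
   and y_{-1}, x_0, y_1, ..., each of which satisfies
   z_{n+1} z_n z_{n-1} = b z_{n-1} + c.  The partial products of such a sequence
   obey the linear recurrence w_{n+3} = b w_{n+1} + c w_n, hence are combinations
   of Padovan numbers, and each z_n is a ratio of consecutive products. *)
Require Import Defs.
From HB Require Import structures.
From mathcomp Require Import all_boot all_order all_algebra.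
From mathcomp Require Import reals.
From mathcomp Require Import zify ring.

Set Implicit Arguments.
Unset Strict Implicit.
Unset Printing Implicit Defensive.

Import Order.TTheory GRing.Theory Num.Theory.

Local Open Scope ring_scope.

Lemma padovanS3 (R : realType) (b c : R) (n : nat) :
  padovan b c n.+3 = b * padovan b c n.+1 + c * padovan b c n.
Proof. by []. Qed.

(** Both sides, as functions of m, satisfy the same third-order linear recurrence, so agreement at m
    = 0, 1, 2 suffices. *)
Lemma prod_padovan (R : realType) (b c : R) (z : nat -> R)
    (rec_z : forall k, z k.+2 * z k.+1 * z k = b * z k + c) (m : nat) :
  \prod_(i < m.+2) z i =
    c * padovan b c m + padovan b c m.+2 * z 0%N
      + padovan b c m.+1 * z 0%N * z 1%N.
Proof.
(* This is [rec_z k] multiplied by the product of the first k terms. *)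
have rec_w k : \prod_(i < k.+3) z i =
    b * \prod_(i < k.+1) z i + c * \prod_(i < k) z i.
  rewrite !big_ord_recr /=; have := rec_z k.
  by move: (\prod_(i < k) z i) => w eq_z; ring: eq_z.
elim/ltn_ind: m => -[|[|[|m]]] IHm.
- by rewrite !big_ord_recr big_ord0 /=; ring.
- by rewrite rec_w !big_ord_recr big_ord0 /=; ring.
- by rewrite rec_w !big_ord_recr big_ord0 /=; ring.
by rewrite rec_w !IHm ?ltnS ?leqnSn ?leqW // !padovanS3; ring.
Qed.

(** The numerator is the product of the first m+3 terms and the denominator that of the first m+2,
    which is nonzero. *)
Lemma ratio_padovan (R : realType) (b c : R) (z : nat -> R)
    (z_neq0 : forall k, z k != 0)
    (rec_z : forall k, z k.+2 * z k.+1 * z k = b * z k + c) (m : nat) :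
  z m.+2 =
    (c * padovan b c m.+1 + padovan b c m.+3 * z 0%N
       + padovan b c m.+2 * z 0%N * z 1%N) /
    (c * padovan b c m + padovan b c m.+2 * z 0%N
       + padovan b c m.+1 * z 0%N * z 1%N).
Proof.
rewrite -!(prod_padovan rec_z) [in RHS]big_ord_recr /= mulrAC divff ?mul1r //.
by apply/prodf_neq0 => i _.
Qed.

(* Position [k] holds the term of index [k - 1]. *)
Definition interlace (R : realType) (x y : int -> R) (k : nat) : R :=
  (if odd k then y else x) (k%:Z - 1).

(** By this symmetry the interlaced sequence starting at y_{-1} needs no separate treatment. *)
Lemma solutionC (R : realType) (b c : R) (x y : int -> R) :
  is_solution b c x y -> is_solution b c y x.
Proof. by move=> sol n /sol[]. Qed.

Lemma well_definedC (R : realType) (x y : int -> R) :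
  well_defined x y -> well_defined y x.
Proof. by move=> wd n /wd; rewrite mulrC. Qed.

Lemma interlace_neq0 (R : realType) (x y : int -> R) (k : nat) :
  well_defined x y -> interlace x y k != 0.
Proof.
move=> wd; have /wd : -1 <= k%:Z - 1 by lia.
by rewrite mulf_eq0 negb_or /interlace => /andP[]; case: ifP.
Qed.

Lemma interlace_rec (R : realType) (b c : R) (x y : int -> R) (k : nat) :
  is_solution b c x y -> well_defined x y ->
  let z := interlace x y in z k.+2 * z k.+1 * z k = b * z k + c.
Proof.
move=> sol wd z.
have := interlace_neq0 k.+1 wd; have := interlace_neq0 k wd.
have [] := sol k%:Z isT.
rewrite /z /interlace /= negbK (_ : k.+2%:Z - 1 = k%:Z + 1); last by lia.
rewrite (_ : k.+1%:Z - 1 = k%:Z); last by lia.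
(* The parity of k selects which of the two equations at n = k has its denominator cleared. *)
by case: (odd k) => /= eq_x eq_y zk_neq0 zk1_neq0;
  rewrite ?eq_x ?eq_y; field; rewrite zk_neq0 zk1_neq0.
Qed.

(** Index m+1 sits at position m+2, which has the parity of m. *)
Lemma interlace_formula (R : realType) (b c : R) (x y : int -> R) (m : nat) :
  is_solution b c x y -> well_defined x y ->
  (if odd m then y else x) m.+1%:Z =
    (c * padovan b c m.+1 + padovan b c m.+3 * x (-1)
       + padovan b c m.+2 * x (-1) * y 0) /
    (c * padovan b c m + padovan b c m.+2 * x (-1)
       + padovan b c m.+1 * x (-1) * y 0).
Proof.
move=> sol wd.
have := ratio_padovan (fun k => interlace_neq0 k wd)
  (fun k => interlace_rec k sol wd) m.
rewrite {1 2 3 4 5 6 7}/interlace /= negbK.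
by rewrite (_ : m.+2%:Z - 1 = m.+1%:Z) //; lia.
Qed.

Theorem corollary7 (R : realType) (b c : R) (x y : int -> R)
    (c_neq0 : c != 0)
    (sol_xy : is_solution b c x y)
    (wd_xy : well_defined x y)
    (n : nat) :
  let P := padovan b c in
  [/\ x (2 * n + 1)%N%:Z =
        (c * P (2 * n + 1)%N + P (2 * n + 3)%N * x (-1)
           + P (2 * n + 2)%N * x (-1) * y 0) /
        (c * P (2 * n)%N + P (2 * n + 2)%N * x (-1)
           + P (2 * n + 1)%N * x (-1) * y 0),
      x (2 * n + 2)%N%:Z =
        (c * P (2 * n + 2)%N + P (2 * n + 4)%N * y (-1)
           + P (2 * n + 3)%N * x 0 * y (-1)) /
        (c * P (2 * n + 1)%N + P (2 * n + 3)%N * y (-1)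
           + P (2 * n + 2)%N * x 0 * y (-1)),
      y (2 * n + 1)%N%:Z =
        (c * P (2 * n + 1)%N + P (2 * n + 3)%N * y (-1)
           + P (2 * n + 2)%N * x 0 * y (-1)) /
        (c * P (2 * n)%N + P (2 * n + 2)%N * y (-1)
           + P (2 * n + 1)%N * x 0 * y (-1))
    & y (2 * n + 2)%N%:Z =
        (c * P (2 * n + 2)%N + P (2 * n + 4)%N * x (-1)
           + P (2 * n + 3)%N * x (-1) * y 0) /
        (c * P (2 * n + 1)%N + P (2 * n + 3)%N * x (-1)
           + P (2 * n + 2)%N * x (-1) * y 0)].
Proof.
move=> P; have sol_yx := solutionC sol_xy; have wd_yx := well_definedC wd_xy.
have even2 : odd (2 * n) = false by rewrite mul2n odd_double.
(* The even argument 2n gives the terms of index 2n+1, the odd argument 2n+1 those of index 2n+2. *)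
have := interlace_formula (2 * n) sol_xy wd_xy.
have := interlace_formula (2 * n) sol_yx wd_yx.
have := interlace_formula (2 * n).+1 sol_xy wd_xy.
have := interlace_formula (2 * n).+1 sol_yx wd_yx.
rewrite [odd _.+1]/= even2 -/P !addnS !addn0 => x2 y2 y1 x1.
(* The exchanged system yields y_{-1} x_0, whereas the goal has x_0 y_{-1}. *)
by split; rewrite ?x1 ?x2 ?y1 ?y2 // ![_ * x 0 * _]mulrAC.
Qed.
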